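(* Let $\Gamma$ be an additive subgroup of $\mathbb{R}$, let $E$ be a finite set, and let $\nu_{\mathsf{P}}\colon\Delta_E^r\to\overline{\Gamma}$ be an $M$-convex function of rank $r$ (a valuated discrete polymatroid $\mathsf{P}$). Define $\widetilde{\nu}_{\mathsf{P}}\colon\Delta_E^{\leq r}\to\overline{\Gamma}$ by $\widetilde{\nu}_{\mathsf{P}}(\alpha)=\min\{\nu_{\mathsf{P}}(\beta)\mid \beta\in\Delta_E^r,\ \alpha_e\leq\beta_e \text{ for all } e\in E\}$. Fix $0<q\leq 1$ and set $$I_k(\mathsf{P}):=\sum_{\alpha\in\Delta_E^k}\frac{q^{\widetilde{\nu}_{\mathsf{P}}(\alpha)}}{\alpha!}\qquad(0\leq k\leq r),$$ with the convention $q^\infty=0$. Then for all $1\leq k<r$, $$I_k(\mathsf{P})^2\ \geq\ \frac{k+1}{k}\, I_{k+1}(\mathsf{P})\, I_{k-1}(\mathsf{P}).$$ In particular the sequence $(I_k(\mathsf{P}))_k$ is log-concave.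
   Context: $\overline{\Gamma}=\Gamma\sqcup\{\infty\}$ with $\infty$ larger than every element of $\Gamma$. For $s\in E$, $e_s\in\mathbb{Z}^E$ is the standard basis vector. $\Delta_E^k=\{\alpha\in\mathbb{Z}_{\geq0}^E\mid \sum_{e\in E}\alpha_e=k\}$ and $\Delta_E^{\leq r}=\{\alpha\in\mathbb{Z}_{\ge0}^E\mid \sum_e\alpha_e\leq r\}$. For $\alpha\in\mathbb{Z}_{\ge0}^E$, $\alpha!=\prod_{e\in E}\alpha_e!$. An $M$-convex function of rank $r$ is a map $\nu\colon\Delta_E^r\to\overline{\Gamma}$, not identically $\infty$, such that for all $\alpha,\beta\in\Delta_E^r$ and every $s\in E$ with $\alpha_s>\beta_s$ there exists $t\in E$ with $\beta_t>\alpha_t$ and $\nu(\alpha)+\nu(\beta)\geq\nu(\alpha-e_s+e_t)+\nu(\beta-e_t+e_s)$. *)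

(* Defs.v *)
From HB Require Import structures.
From mathcomp Require Import all_boot all_order all_algebra.
From mathcomp Require Import reals exp.
Set Implicit Arguments. Unset Strict Implicit. Unset Printing Implicit Defensive.
Import Order.TTheory GRing.Theory Num.Theory.
Local Open Scope ring_scope.

(* Extended values  Gamma-bar = Gamma ⊔ {oo}  are encoded as  option R,
   with None = oo (larger than everything, absorbing for +). *)
Definition oadd {R : realType} (x y : option R) : option R :=
  match x, y with Some a, Some b => Some (a + b) | _, _ => None end.
Definition ole {R : realType} (x y : option R) : bool :=
  match x, y with
  | _, None => true
  | None, Some _ => false
  | Some a, Some b => a <= b
  end.
Definition omin {R : realType} (x y : option R) : option R :=
  if ole x y then x else y.

Definition mdeg {E : finType} (a : {ffun E -> nat}) : nat := (\sum_(e : E) a e)%N.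
Definition inDelta {E : finType} (r : nat) (a : {ffun E -> nat}) : bool := mdeg a == r.

Definition exch {E : finType} (a : {ffun E -> nat}) (s t : E) : {ffun E -> nat} :=
  [ffun e => (a e - (e == s) + (e == t))%N].

(* M-convex function of rank r with values in Gamma-bar (G = Gamma).
   Only the values of nu on Delta_E^r matter. *)
Definition Mconvex {R : realType} {E : finType} (G : {pred R}) (r : nat)
  (nu : {ffun E -> nat} -> option R) : Prop :=
  (forall a x, inDelta r a -> nu a = Some x -> x \in G) /\
  (exists a, inDelta r a /\ nu a <> None) /\
  (forall a b s, inDelta r a -> inDelta r b -> (b s < a s)%N ->
     exists t, (a t < b t)%N /\
       ole (oadd (nu (exch a s t)) (nu (exch b t s))) (oadd (nu a) (nu b))).

Definition addsubgroup {R : realType} (G : {pred R}) : Prop :=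
  0 \in G /\ (forall x y, x \in G -> y \in G -> x - y \in G).

(* Multi-indices with entries <= r, viewed in nat. Every alpha in Delta_E^k
   with k <= r is of this form (bijectively). *)
Definition lft {E : finType} {r : nat} (a : {ffun E -> 'I_r.+1}) : {ffun E -> nat} :=
  [ffun e => nat_of_ord (a e)].

Definition nutilde {R : realType} {E : finType} (r : nat)
  (nu : {ffun E -> nat} -> option R) (a : {ffun E -> nat}) : option R :=
  \big[omin/None]_(b : {ffun E -> 'I_r.+1} |
       inDelta r (lft b) && [forall e, (a e <= lft b e)%N]) nu (lft b).

Definition qpow {R : realType} (q : R) (x : option R) : R :=
  match x with Some a => powR q a | None => 0 end.

Definition mfact {E : finType} (a : {ffun E -> nat}) : nat := (\prod_(e : E) (a e)`!)%N.

Definition Ik {R : realType} {E : finType} (r : nat)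
  (nu : {ffun E -> nat} -> option R) (q : R) (k : nat) : R :=
  \sum_(a : {ffun E -> 'I_r.+1} | mdeg (lft a) == k)
     qpow q (nutilde r nu (lft a)) / (mfact (lft a))%:R.

(* Main.v *)
Require Import Defs.
From HB Require Import structures.
From mathcomp Require Import all_boot all_order all_algebra.
From mathcomp Require Import reals exp.
From mathcomp Require Import ring lra zify.
From mathcomp Require polyrcf.
Set Implicit Arguments. Unset Strict Implicit. Unset Printing Implicit Defensive.
Import Order.TTheory GRing.Theory Num.Theory.
Local Open Scope ring_scope.

(** Write f(a) = q^nutilde(a). The homogenised generating polynomial
    F = \sum_a f(a) w^a / a! * w_0^(r-|a|) / (r-|a|)! is Lorentzian: at a positive
    point, the Hessian of each partial derivative satisfies the reverse
    Cauchy-Schwarz inequality, and letting w_0 tend to 0 with the other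
    variables equal to 1 gives k! I_k log-concave.
    For quadratic derivatives, the exchange inequality makes the Hessian, after
    scaling and subtraction from a rank one matrix, an ultrametric matrix, which
    is positive semidefinite. In higher degree, Euler's identity writes the
    Hessian as a positive combination of the Hessians of the first derivatives;
    the inequality passes to the combination because w_0 is linked to every
    variable that occurs. Exchange for nutilde at all levels below r is obtained
    from level r by lowering the rank one unit at a time. *)

(** * Reverse Cauchy-Schwarz for nonnegative symmetric matrices *)

Definition bil (R : pzRingType) (I : finType) (M : I -> I -> R) (x y : I -> R) : R :=
  \sum_i x i * \sum_j M i j * y j.

Lemma bil_comb (R : comPzRingType) (I : finType) (M : I -> I -> R) (p q : R) (x y : I -> R) :
  (forall i j, M i j = M j i) ->
  bil M (fun i => p * x i + q * y i) (fun i => p * x i + q * y i) =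
  p ^+ 2 * bil M x x + p * q *+ 2 * bil M x y + q ^+ 2 * bil M y y.
Proof.
move=> symM.
have symB : bil M x y = bil M y x.
  rewrite /bil.
  transitivity (\sum_i \sum_j x i * (M i j * y j)).
    by apply: eq_bigr => i _; rewrite mulr_sumr.
  rewrite exchange_big; apply: eq_bigr => j _ /=; rewrite mulr_sumr.
  by apply: eq_bigr => i _; rewrite symM; ring.
have -> : p ^+ 2 * bil M x x + p * q *+ 2 * bil M x y + q ^+ 2 * bil M y y =
  p * (p * bil M x x + q * bil M x y) + q * (p * bil M y x + q * bil M y y).
  by rewrite -symB; ring.
rewrite /bil !mulr_sumr -!big_split /= !mulr_sumr -big_split /=.
apply: eq_bigr => i _.
have -> : \sum_j M i j * (p * x j + q * y j) =
   p * (\sum_j M i j * x j) + q * (\sum_j M i j * y j).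
  by rewrite !mulr_sumr -big_split; apply: eq_bigr => j _ /=; ring.
ring.
Qed.

(** Fredholm alternative: each column of [cokermx A] lies in the kernel of [L], and a row orthogonal
    to all these columns lies in the row space of [A]. *)
Lemma solve_of_orthogonal_kernel (F : fieldType) (I : finType) (L : I -> I -> F) (b : I -> F) :
  (forall z, (forall i, \sum_j L i j * z j = 0) -> \sum_i b i * z i = 0) ->
  exists y, forall i, \sum_j y j * L j i = b i.
Proof.
move=> orth.
pose A : 'M[F]_#|I| := \matrix_(i, j) L (enum_val i) (enum_val j).
pose v : 'rV[F]_#|I| := \row_i b (enum_val i).
have sumI (f : I -> F) : \sum_i f i = \sum_(k < #|I|) f (enum_val k).
  by rewrite (reindex (@enum_val _ I)) //=; exact: onW_bij (@enum_val_bij I).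
have : (v <= A)%MS.
  rewrite submxE; apply/eqP/rowP => k; rewrite !mxE.
  transitivity (\sum_i b i * cokermx A (enum_rank i) k).
    by rewrite sumI; apply: eq_bigr => i _; rewrite [v _ _]mxE enum_valK.
  apply: (orth (fun i => cokermx A (enum_rank i) k)) => i.
  transitivity ((A *m cokermx A) (enum_rank i) k); last by rewrite mulmx_coker mxE.
  by rewrite mxE sumI; apply: eq_bigr => j _; rewrite [A _ _]mxE enum_rankK enum_valK.
case/submxP => y yA; exists (fun i => y 0 (enum_rank i)) => i.
have /matrixP/(_ 0 (enum_rank i)) := yA; rewrite !mxE enum_rankK => ->.
by rewrite sumI; apply: eq_bigr => j _; rewrite [A _ _]mxE enum_rankK enum_valK.
Qed.

(** The second vector is fixed to be all ones; a general positive point is brought there by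
    rescaling the matrix, as [hessian] does. *)
Definition reverse_CS (R : numDomainType) (I : finType) (M : I -> I -> R) :=
  forall x, bil M x x * bil M (fun=> 1) (fun=> 1) <= bil M x (fun=> 1) ^+ 2.

Section Core.
Variables (R : realFieldType) (I : finType) (M : I -> I -> R) (o : I).
Hypothesis symM : forall i j, M i j = M j i.
Hypothesis M_ge0 : forall i j, 0 <= M i j.
Let s i := \sum_j M i j.
Hypothesis conn : forall i j, 0 < M i j -> 0 < M i o.

Lemma laplacian_sum_squares (z : I -> R) :
  \sum_i s i * z i ^+ 2 - bil M z z = 2^-1 * \sum_i \sum_j M i j * (z i - z j) ^+ 2.
Proof.
have -> : \sum_i \sum_j M i j * (z i - z j) ^+ 2 =
   \sum_i s i * z i ^+ 2 - bil M z z *+ 2 + \sum_i s i * z i ^+ 2.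
  have -> : \sum_i s i * z i ^+ 2 - bil M z z *+ 2 + \sum_i s i * z i ^+ 2 =
     \sum_i \sum_j (M i j * z i ^+ 2 - (z i * (M i j * z j)) *+ 2) + \sum_j \sum_i M j i * z j ^+ 2.
    congr (_ + _); last by apply: eq_bigr => i _; rewrite /s mulr_suml.
    rewrite /bil -sumrMnl -sumrB; apply: eq_bigr => i _.
    by rewrite /s mulr_suml mulr_sumr -sumrMnl -sumrB.
  rewrite [X in _ = _ + X]exchange_big -big_split /=; apply: eq_bigr => i _.
  by rewrite -big_split /=; apply: eq_bigr => j _; rewrite (symM j i); ring.
by field.
Qed.

Lemma laplacian_ge0 z : bil M z z <= \sum_i s i * z i ^+ 2.
Proof.
rewrite -subr_ge0 laplacian_sum_squares mulr_ge0 ?invr_ge0 ?ler0n //.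
by apply: sumr_ge0 => i _; apply: sumr_ge0 => j _; rewrite mulr_ge0 ?sqr_ge0.
Qed.

(** The Dirichlet energy of [z] vanishes, so [z] agrees across every edge; [conn] joins each vertex
    of nonzero degree directly to [o], and the others have [s i = 0]. *)
Lemma laplacian_kernel z :
  (forall i, s i * z i = \sum_j M i j * z j) -> forall i, s i * z i = s i * z o.
Proof.
move=> kz i.
have E0 : \sum_i \sum_j M i j * (z i - z j) ^+ 2 = 0.
  have : \sum_i s i * z i ^+ 2 - bil M z z = 0.
    by apply/eqP; rewrite subr_eq0; apply/eqP/eq_bigr => k _; rewrite -kz; ring.
  by rewrite laplacian_sum_squares; lra.
have F k j : M k j * (z k - z j) ^+ 2 = 0.
  have nn k' j' : 0 <= M k' j' * (z k' - z j') ^+ 2 by rewrite mulr_ge0 ?sqr_ge0.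
  have /psumr_eq0P := E0 => /(_ (fun k _ => sumr_ge0 _ (fun j _ => nn k j)) k isT) Ek.
  exact: (psumr_eq0P (fun j _ => nn k j) Ek).
have [Mio|Mio] := ltP 0 (M i o).
  have /eqP := F i o; rewrite mulf_eq0 (gt_eqF Mio) /= sqrf_eq0 subr_eq0.
  by move/eqP->.
have -> : s i = 0; last by rewrite !mul0r.
apply: big1 => j _; apply/eqP; rewrite eq_le M_ge0 andbT leNgt.
by apply/negP => /conn; rewrite ltNge Mio.
Qed.

(* With L = diag(s) - M the Laplacian, solve L y = s x, which is possible as s x
   is orthogonal to ker L. The hypothesis at y reads y.(L y) <= x.(s x), and
   expanding 0 <= (x - y).(L (x - y)) then gives x.(M x) <= 0. *)
Lemma negative_on_complement :
  (forall x, bil M x x <= \sum_k (\sum_j M k j * x j) ^+ 2 / s k) ->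
  forall x, \sum_i s i * x i = 0 -> bil M x x <= 0.
Proof.
move=> contr x x0.
pose L i j := (i == j)%:R * s i - M i j.
have Lsum (z : I -> R) i : \sum_j L i j * z j = s i * z i - \sum_j M i j * z j.
  rewrite /L -[X in X - _](_ : \sum_j (i == j)%:R * s i * z j = _).
    by rewrite -sumrB; apply: eq_bigr => j _; rewrite mulrBl.
  rewrite (bigD1 i) //= eqxx mul1r big1 ?addr0 // => j /negPf.
  by rewrite eq_sym => ->; rewrite !mul0r.
have [z kz|y Ly] := @solve_of_orthogonal_kernel _ _ L (fun i => s i * x i).
  have kz' i : s i * z i = \sum_j M i j * z j.
    by apply/eqP; rewrite -subr_eq0 -Lsum kz.
  have zE := laplacian_kernel kz'.
  transitivity (z o * \sum_i s i * x i); last by rewrite x0 mulr0.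
  by rewrite mulr_sumr; apply: eq_bigr => i _; rewrite mulrAC zE; ring.
have My i : \sum_j M i j * y j = s i * (y i - x i).
  have := Ly i; rewrite (eq_bigr (fun j => L i j * y j)); last first.
    move=> j _; rewrite /L symM (eq_sym j); case: eqP => [->|_] //=; ring.
  by rewrite Lsum mulrBr => <-; ring.
have s_ge0 i : 0 <= s i by apply: sumr_ge0.
have yy : bil M y y = \sum_i s i * (y i ^+ 2 - x i * y i).
  by apply: eq_bigr => i _; rewrite My; ring.
have xy : bil M x y = \sum_i s i * (x i * y i - x i ^+ 2).
  by apply: eq_bigr => i _; rewrite My; ring.
have B1 : \sum_i s i * (x i * y i) <= \sum_i s i * x i ^+ 2.
  have := contr y; rewrite yy.
  rewrite [X in _ <= X](_ : _ = \sum_i s i * (y i - x i) ^+ 2); last first.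
    apply: eq_bigr => i _; rewrite My.
    by have [->|s0] := eqVneq (s i) 0; [rewrite !mul0r expr0n mul0r | field].
  rewrite -subr_ge0 -sumrB => h; rewrite -subr_ge0 -sumrB; move: h.
  rewrite (eq_bigr (fun i => s i * x i ^+ 2 - s i * (x i * y i))) // => i _.
  ring.
have B2 := laplacian_ge0 (fun i => 1 * x i + (-1) * y i).
rewrite bil_comb // in B2.
rewrite xy yy in B2.
have E1 : \sum_i s i * (x i * y i - x i ^+ 2) =
   \sum_i s i * (x i * y i) - \sum_i s i * x i ^+ 2.
  by rewrite -sumrB; apply: eq_bigr => i _; rewrite mulrBr.
have E2 : \sum_i s i * (y i ^+ 2 - x i * y i) =
   \sum_i s i * y i ^+ 2 - \sum_i s i * (x i * y i).
  by rewrite -sumrB; apply: eq_bigr => i _; rewrite mulrBr.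
have E3 : \sum_i s i * (1 * x i + -1 * y i) ^+ 2 =
   \sum_i s i * x i ^+ 2 - (\sum_i s i * (x i * y i)) *+ 2 + \sum_i s i * y i ^+ 2.
  by rewrite -sumrMnl -sumrB -big_split; apply: eq_bigr => i _ /=; ring.
rewrite E1 E2 E3 in B2.
lra.
Qed.

End Core.

Lemma bilr1 (R : pzRingType) (I : finType) (M : I -> I -> R) (x : I -> R) :
  bil M x (fun=> 1) = \sum_i x i * \sum_j M i j.
Proof.
by apply: eq_bigr => i _; congr (_ * _); apply: eq_bigr => j _; rewrite mulr1.
Qed.

(** Dividing the inequality for [Mk k] by the total of [Mk k], which is the [k]-th row sum of [M],
    and summing over [k] gives the bound that [negative_on_complement] requires. *)
Lemma reverse_CS_sum (R : realFieldType) (I : finType) (o : I)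
  (M : I -> I -> R) (Mk : I -> I -> I -> R) :
  (forall i j, M i j = M j i) ->
  (forall i j, 0 < M i j -> 0 < M i o) ->
  (forall k i j, 0 <= Mk k i j) ->
  (forall i j, M i j = \sum_k Mk k i j) ->
  (forall k i, \sum_j Mk k i j = M k i) ->
  (forall k, reverse_CS (Mk k)) ->
  reverse_CS M.
Proof.
move=> symM conn Mk0 Msum Mrow RCS x.
have M0 i j : 0 <= M i j by rewrite Msum sumr_ge0.
have contr y : bil M y y <= \sum_k (\sum_j M k j * y j) ^+ 2 / \sum_j M k j.
  have -> : bil M y y = \sum_k bil (Mk k) y y.
    rewrite /bil [RHS]exchange_big; apply: eq_bigr => i _ /=.
    rewrite -mulr_sumr exchange_big; congr (_ * _); apply: eq_bigr => j _ /=.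
    by rewrite Msum mulr_suml.
  apply: ler_sum => k _.
  have := RCS k y.
  have -> : bil (Mk k) (fun=> 1) (fun=> 1) = \sum_j M k j.
    by rewrite bilr1; apply: eq_bigr => i _; rewrite mul1r Mrow.
  have -> : bil (Mk k) y (fun=> 1) = \sum_j M k j * y j.
    by rewrite bilr1; apply: eq_bigr => i _; rewrite Mrow mulrC.
  have : 0 <= \sum_j M k j by apply: sumr_ge0.
  rewrite le_eqVlt => /orP[/eqP s0 _|s_gt0]; last by rewrite ler_pdivlMr.
  (* A zero row sum forces all of [Mk k] to vanish, in agreement with division by 0 being 0. *)
  rewrite -s0 invr0 mulr0.
  have Mk_0 j : M k j = 0 by apply: (psumr_eq0P (fun j _ => M0 k j) (esym s0)).
  have Mkk i j : Mk k i j = 0.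
    exact: (psumr_eq0P (fun j _ => Mk0 k i j) (etrans (Mrow k i) (Mk_0 i))).
  rewrite /bil big1 // => i _; rewrite big1 ?mulr0 // => j _.
  by rewrite Mkk mul0r.
have neg := negative_on_complement symM M0 conn contr.
set t := bil M x (fun=> 1); set b := bil M (fun=> 1) (fun=> 1).
have b0 : 0 <= b.
  rewrite /b bilr1; apply: sumr_ge0 => i _; rewrite mul1r.
  exact: sumr_ge0.
move: b0; rewrite le_eqVlt => /orP[/eqP<-|b_gt0]; first by rewrite mulr0 sqr_ge0.
have /neg : \sum_i (\sum_j M i j) * (b * x i + (- t) * 1) = 0.
  transitivity (b * t - t * b); last by ring.
  rewrite {2}/t {3}/b !bilr1 [b * _]mulr_sumr [t * _]mulr_sumr -sumrB.
  by apply: eq_bigr => i _; ring.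
rewrite bil_comb // -/t -/b.
have -> : b ^+ 2 * bil M x x + b * - t *+ 2 * t + (- t) ^+ 2 * b =
  b * (bil M x x * b - t ^+ 2) by ring.
by rewrite pmulr_rle0 // subr_le0.
Qed.

(** * Quadratic case: rank one bounds and ultrametric matrices *)

Lemma reverse_CS_of_rank1_bound (R : realFieldType) (I : finType)
  (M : I -> I -> R) (a : R) (l : I -> R) :
  (forall i j, M i j = M j i) -> (forall i j, 0 <= M i j) -> 0 < a ->
  (forall x, a * bil M x x <= (\sum_i l i * x i) ^+ 2) ->
  reverse_CS M.
Proof.
move=> symM M0 a0 bnd x.
set t := bil M x (fun=> 1); set b := bil M (fun=> 1) (fun=> 1).
have b0 : 0 <= b.
  rewrite /b bilr1; apply: sumr_ge0 => i _; rewrite mul1r.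
  exact: sumr_ge0.
move: b0; rewrite le_eqVlt => /orP[/eqP<-|b_gt0]; first by rewrite mulr0 sqr_ge0.
pose p := \sum_i l i * 1; pose c := \sum_i l i * x i.
have p2 : 0 < p ^+ 2 by apply: lt_le_trans (bnd (fun=> 1)); rewrite mulr_gt0.
(* This vector lies in the kernel of [l], so the form is nonpositive there; [b] times its value is
   [p^2 (A b - t^2) + (c b - p t)^2] with [A = bil M x x]. *)
have := bnd (fun i => p * x i + (- c) * 1).
have -> : \sum_i l i * (p * x i + - c * 1) = 0.
  transitivity (p * c - c * p); last by ring.
  by rewrite {2}/c {3}/p [p * _]mulr_sumr [c * _]mulr_sumr -sumrB; apply: eq_bigr => i _; ring.
rewrite bil_comb // -/t -/b expr0n /= pmulr_rle0 //.
set A := bil M x x => h.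
have {h} h : b * (p ^+ 2 * A + p * - c *+ 2 * t + (- c) ^+ 2 * b) <= 0.
  by rewrite pmulr_rle0.
have : p ^+ 2 * (A * b - t ^+ 2) <= 0.
  apply: le_trans h; rewrite -subr_ge0.
  apply: le_trans (sqr_ge0 (c * b - p * t)) _.
  by rewrite le_eqVlt; apply/orP; left; apply/eqP; ring.
by rewrite pmulr_rle0 // subr_le0.
Qed.

Lemma partial_equivalence_psd (R : realFieldType) (I : finType) (e : rel I) (y : I -> R) :
  symmetric e -> transitive e ->
  0 <= \sum_i \sum_j y i * y j * (e i j)%:R.
Proof.
move=> syme tre.
pose n j : R := \sum_k (e j k)%:R.
have n0 j : 0 <= n j by apply: sumr_ge0.
(* e is the Gram matrix of its rows weighted by inverse class sizes. *)
have eE i j : (e i j)%:R = \sum_k (e k i)%:R * (e k j)%:R / n k :> R.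
  case eij: (e i j); last first.
    rewrite big1 // => k _.
    case eki: (e k i); case ekj: (e k j); rewrite ?mul0r ?mulr0 ?mul0r //.
    by move: eij; rewrite (tre k) // syme.
  have nE k : e k i -> n k = n i.
    move=> eki; apply: eq_bigr => m _; congr (_%:R); congr nat_of_bool; apply/idP/idP.
      by apply: tre; rewrite syme.
    exact: tre.
  transitivity (\sum_k (e i k)%:R / n i).
    rewrite -mulr_suml -/(n i) divff // gt_eqF // /n (bigD1 j) //= eij.
    by rewrite ltr_pwDl ?sumr_ge0.
  apply: eq_bigr => k _; rewrite (syme i k); case eki: (e k i); rewrite ?mul0r //.
  by rewrite (nE k) // (tre i k j eki eij) /= mulr1.
have -> : \sum_i \sum_j y i * y j * (e i j)%:R =
   \sum_k (\sum_i (e k i)%:R * y i) ^+ 2 / n k.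
  transitivity (\sum_i \sum_j \sum_k y i * y j * ((e k i)%:R * (e k j)%:R / n k)).
    by apply: eq_bigr => i _; apply: eq_bigr => j _; rewrite eE mulr_sumr.
  under eq_bigr => i _ do rewrite exchange_big.
  rewrite exchange_big /=; apply: eq_bigr => k _.
  rewrite expr2 mulr_suml mulr_suml; apply: eq_bigr => i _.
  by rewrite mulr_sumr mulr_suml; apply: eq_bigr => j _; ring.
by apply: sumr_ge0 => k _; rewrite divr_ge0 ?sqr_ge0.
Qed.

(* Subtract the least positive entry from the support, which is a partial
   equivalence relation, and induct on the size of the support. *)
Lemma ultrametric_psd (R : realFieldType) (I : finType) (S : I -> I -> R) (y : I -> R) :
  (forall i j, S i j = S j i) -> (forall i j, 0 <= S i j) ->
  (forall i j k, Num.min (S i k) (S k j) <= S i j) ->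
  0 <= \sum_i \sum_j y i * y j * S i j.
Proof.
have [n] := ubnP #|[set p : I * I | 0 < S p.1 p.2]|.
elim: n S => // n IHn S ltn symS S0 ultS.
case: (pickP (fun p : I * I => 0 < S p.1 p.2)) => [p0 p0P|none]; last first.
  rewrite big1 // => i _; rewrite big1 // => j _.
  by have := none (i, j); rewrite lt_neqAle S0 andbT eq_sym => /negbFE/eqP ->; rewrite mulr0.
case: (@arg_minP _ _ _ p0 (fun p => 0 < S p.1 p.2) (fun p => S p.1 p.2) p0P) => p pP pmin.
set m := S p.1 p.2 in pP pmin.
pose e : rel I := fun i j => 0 < S i j.
have syme : symmetric e by move=> i j; rewrite /e symS.
have tre : transitive e.
  move=> k i j eik ekj; apply: lt_le_trans (ultS i j k).
  by rewrite lt_min; apply/andP.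
pose S' i j := S i j - m * (e i j)%:R.
have S'0 i j : 0 <= S' i j.
  rewrite /S'; case eij: (e i j); rewrite ?mulr0 ?subr0 //.
  by rewrite mulr1 subr_ge0; apply: (pmin (i, j)).
have S'N i j : ~~ e i j -> S' i j = 0.
  move=> eij; rewrite /S' (negPf eij) mulr0 subr0.
  by apply/eqP; rewrite eq_le S0 andbT leNgt.
have -> : \sum_i \sum_j y i * y j * S i j =
   \sum_i \sum_j y i * y j * S' i j + m * \sum_i \sum_j y i * y j * (e i j)%:R.
  rewrite mulr_sumr -big_split; apply: eq_bigr => i _ /=.
  by rewrite mulr_sumr -big_split; apply: eq_bigr => j _ /=; rewrite /S'; ring.
apply: addr_ge0; last by rewrite mulr_ge0 ?(ltW pP) ?partial_equivalence_psd.
apply: IHn => //.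
- rewrite ltnS in ltn; apply: leq_trans ltn; apply: proper_card; apply/properP; split.
    apply/subsetP => -[i j]; rewrite !inE /= => h; apply: contraTT h => eij.
    by rewrite S'N // ltxx.
  exists p; rewrite inE //= /S' /e -/m pP mulr1 subrr ltxx //.
- by move=> i j; rewrite /S' symS syme.
- move=> i j k.
  have [eik|eik] := boolP (e i k); last by rewrite S'N // ge_min S'0.
  have [ekj|ekj] := boolP (e k j); last by rewrite (S'N k) // ge_min S'0 orbT.
  rewrite /S' eik ekj (tre k) // mulr1 ge_min !lerD2r -ge_min.
  exact: ultS.
Qed.

(** A multiplicative four-point condition, as for tree metrics, with base point [o]. Dividing by
    [u i * u j * u k] turns it into the ultrametric inequality for [S], and the entries
    [u i * u j * S i j] are the defect in the claimed bound. *)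
Lemma four_point_rank1_bound (R : realFieldType) (I : finType) (D : I -> I -> R) (o : I) :
  (forall i j, D i j = D j i) -> (forall i j, 0 <= D i j) ->
  (forall i j, D i j <= D i o) ->
  (forall i j k, D k o * D i j <= Num.max (D i o * D k j) (D j o * D i k)) ->
  forall x, D o o * bil D x x <= (\sum_i D i o * x i) ^+ 2.
Proof.
move=> symD D0 Do fp x.
pose u i := D i o.
(* If [u i = 0], the four-point inequality at [k = o] gives [D o o * D i j = 0], so the value 0
   keeps [uS] true. *)
pose S i j := if (u i == 0) || (u j == 0) then 0 else 1 - D o o * D i j / (u i * u j).
have u0 i : 0 <= u i by apply: D0.
have upos i : u i != 0 -> 0 < u i by move=> h; rewrite lt_neqAle eq_sym h u0.
have F2 i j : D o o * D i j <= u i * u j.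
  by have := fp i j o; rewrite (symD o j) [D j o * _]mulrC maxxx.
have uS i j : u i * u j * S i j = u i * u j - D o o * D i j.
  rewrite /S; have [ui|ui] /= := eqVneq (u i) 0.
    by have := F2 i j; have := mulr_ge0 (D0 o o) (D0 i j); rewrite ui; lra.
  have [uj|uj] /= := eqVneq (u j) 0.
    by have := F2 i j; have := mulr_ge0 (D0 o o) (D0 i j); rewrite uj; lra.
  by field; apply/andP.
have S0 i j : 0 <= S i j.
  rewrite /S; case: ifP => // /negbT; rewrite negb_or => /andP[/upos ui /upos uj].
  by rewrite subr_ge0 ler_pdivrMr ?mulr_gt0 // mul1r.
have symS i j : S i j = S j i by rewrite /S orbC symD [u i * _]mulrC.
have -> : (\sum_i D i o * x i) ^+ 2 =
    D o o * bil D x x + \sum_i \sum_j (u i * x i) * (u j * x j) * S i j.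
  rewrite /bil expr2 mulr_suml mulr_sumr -big_split; apply: eq_bigr => i _ /=.
  rewrite !mulr_sumr -big_split; apply: eq_bigr => j _ /=.
  rewrite (_ : u i * x i * (u j * x j) * S i j = x i * x j * (u i * u j * S i j)); last by ring.
  by rewrite uS /u; ring.
rewrite lerDl; apply: ultrametric_psd => // i j k.
have Sl a b : u a = 0 -> S a b = 0 by move=> ua; rewrite /S ua eqxx.
have Sr a b : u b = 0 -> S a b = 0 by move=> ub; rewrite /S ub eqxx orbT.
have [ui|ui] := eqVneq (u i) 0; first by rewrite ge_min (Sl i k) // S0.
have [uj|uj] := eqVneq (u j) 0; first by rewrite ge_min (Sr k j) // S0 orbT.
have [uk|uk] := eqVneq (u k) 0; first by rewrite ge_min (Sr i k) // S0.
rewrite /S (negPf ui) (negPf uj) (negPf uk) /= ge_min !lerD2l !lerN2.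
have pi := upos i ui; have pj := upos j uj; have pk := upos k uk.
have := fp i j k; rewrite le_max => /orP[] h; apply/orP.
  right; rewrite ler_pdivlMr ?mulr_gt0 // mulrAC ler_pdivrMr ?mulr_gt0 //.
  rewrite (_ : D o o * D i j * _ = (D o o * u j) * (u k * D i j)); last by ring.
  rewrite (_ : D o o * D k j * _ = (D o o * u j) * (u i * D k j)); last by ring.
  by rewrite ler_wpM2l // mulr_ge0.
left; rewrite ler_pdivlMr ?mulr_gt0 // mulrAC ler_pdivrMr ?mulr_gt0 //.
rewrite (_ : D o o * D i j * _ = (D o o * u i) * (u k * D i j)); last by ring.
rewrite (_ : D o o * D i k * _ = (D o o * u i) * (u j * D i k)); last by ring.
by rewrite ler_wpM2l // mulr_ge0.
Qed.

(** * Exchange and truncation *)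

Definition incr {E : finType} (a : {ffun E -> nat}) (s : E) : {ffun E -> nat} :=
  [ffun e => (a e + (e == s))%N].

Lemma incrC {E : finType} (a : {ffun E -> nat}) s t : incr (incr a s) t = incr (incr a t) s.
Proof. by apply/ffunP => e; rewrite !ffunE addnAC. Qed.

Lemma mdeg_incr {E : finType} (a : {ffun E -> nat}) s : mdeg (incr a s) = (mdeg a).+1.
Proof.
have one : (\sum_(e : E) (e == s) = 1)%N.
  by rewrite (bigD1 s) //= eqxx big1 // => e /negPf ->.
rewrite /mdeg; under eq_bigr do rewrite ffunE.
by rewrite big_split /= one addn1.
Qed.

(** The inequality of [Mconvex] read for [f = q^nu]: sums become products, [q <= 1] reverses the
    order, and 0 stands for infinity. *)
Definition exchange {R : realDomainType} {E : finType} (m : nat)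
    (f : {ffun E -> nat} -> R) : Prop :=
  forall a b s, mdeg a = m -> mdeg b = m -> (b s < a s)%N ->
    exists2 t, (a t < b t)%N & f a * f b <= f (exch a s t) * f (exch b t s).

(** Compares multi-indices coordinatewise; [lia] takes from the context the strict inequalities that
    keep the truncated subtraction of [exch] exact. *)
Ltac mi_eq := apply/ffunP => ?; rewrite !ffunE;
  repeat match goal with |- context [?x == ?y] => 
    case: (x =P y) => [?|?]; subst end; try lia.

(* Lift A and B optimally by e_a and e_b and exchange there. The witness fails
   to descend only when it touches a or b; then a second exchange either gives
   a valid witness or shows that a common lift e_b of A and B is also optimal. *)
Lemma exchange_truncation (R : realDomainType) (E : finType) (m : nat)
    (f : {ffun E -> nat} -> R) :
  (forall a, 0 <= f a) ->
  (forall a e, f (incr a e) <= f a) ->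
  (forall a (s : E), mdeg a = m -> exists e, f a = f (incr a e)) ->
  exchange m.+1 f -> exchange m f.
Proof.
move=> f0 mono att exf A B s dA dB ltBA.
have [a fa] := att A s dA; have [b fb] := att B s dB.
(* A common lift preserves all coordinate comparisons, so its witness serves [A] and [B], and
   monotonicity removes the lift. *)
have common e : f A * f B <= f (incr A e) * f (incr B e) ->
    exists2 t, (A t < B t)%N & f A * f B <= f (exch A s t) * f (exch B t s).
  move=> h.
  have [||| t tP tle] := exf (incr A e) (incr B e) s; rewrite ?mdeg_incr ?dA ?dB //.
    by rewrite !ffunE; lia.
  have tP' : (A t < B t)%N by move: tP; rewrite !ffunE; lia.
  exists t => //; apply: (le_trans h); apply: (le_trans tle).
  rewrite (_ : exch (incr A e) s t = incr (exch A s t) e); last by mi_eq.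
  rewrite (_ : exch (incr B e) t s = incr (exch B t s) e); last by mi_eq.
  exact: ler_pM.
have done t e e' : (A t < B t)%N ->
  f A * f B <= f (incr (exch A s t) e) * f (incr (exch B t s) e') ->
  exists2 t, (A t < B t)%N & f A * f B <= f (exch A s t) * f (exch B t s).
  move=> tP h; exists t => //; apply: (le_trans h); exact: ler_pM.
have common' : f A * f B <= f (incr A b) * f (incr B a) ->
    exists2 t, (A t < B t)%N & f A * f B <= f (exch A s t) * f (exch B t s).
  move=> h; apply: (common b); apply: (le_trans h).
  by rewrite -fb ler_wpM2l.
have [eab|ab] := eqVneq a b; first by apply: (common b); rewrite fb {1}fa eab.
have E1 : f A * f B = f (incr A a) * f (incr B b) by rewrite -fa -fb.
(* In this case lifting [B] at [b = s] cancels the excess of [A] at [s]; the lifted pair is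
   exchanged at [a] instead, unless [a] itself is a witness. *)
have [/andP[/eqP eb /eqP eAs]|sb] := boolP ((s == b) && (A s == (B s).+1)).
  subst b.
  have [ltAB|geAB] := ltnP (A a) (B a).
    apply: (done a s a) => //; rewrite E1.
    rewrite (_ : incr (exch A s a) s = incr A a); last by mi_eq.
    by rewrite (_ : incr (exch B a s) a = incr B s) //; mi_eq.
  have [||| t tP tle] := exf (incr A a) (incr B s) a; rewrite ?mdeg_incr ?dA ?dB //.
    by rewrite !ffunE eqxx (negPf ab); lia.
  rewrite !ffunE in tP.
  have ts : t != s by apply/eqP => ts; subst t; move: tP; rewrite eqxx; lia.
  have ta : t != a by apply/eqP => ta; subst t; move: tP; rewrite eqxx (negPf ab); lia.
  rewrite (negPf ts) (negPf ta) !addn0 in tP.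
  apply: (done t s a) => //; rewrite E1; apply: (le_trans tle).
  rewrite (_ : incr (exch A s t) s = exch (incr A a) a t); last by mi_eq.
  by rewrite (_ : incr (exch B t s) a = exch (incr B s) t a) //; mi_eq.
have [||| t tP tle] := exf (incr A a) (incr B b) s; rewrite ?mdeg_incr ?dA ?dB //.
  rewrite !ffunE; case: (s =P b) sb => [eb|_] /=; last by lia.
  by subst b; move/eqP; lia.
rewrite !ffunE in tP.
have [ltAB|geAB] := ltnP (A t) (B t).
  apply: (done t a b) => //; rewrite E1; apply: (le_trans tle).
  rewrite (_ : incr (exch A s t) a = exch (incr A a) s t); last by mi_eq.
  by rewrite (_ : incr (exch B t s) b = exch (incr B b) t s) //; mi_eq.
(* The witness exists only because of the lift of [B], so it is [b]. *)
have tb : t = b by apply/eqP; move: tP; case: eqP => //; lia.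
subst t; rewrite eqxx eq_sym (negPf ab) in tP.
have bs : b != s by apply/eqP => bs; subst b; lia.
have [eas|nas] := eqVneq a s.
  subst a; apply: common'; rewrite E1; apply: (le_trans tle).
  rewrite (_ : exch (incr A s) s b = incr A b); last by mi_eq.
  by rewrite (_ : exch (incr B b) b s = incr B s) //; mi_eq.
have [ltABa|geABa] := ltnP (A a) (B a).
  apply: (done a b a) => //; rewrite E1; apply: (le_trans tle).
  rewrite (_ : incr (exch A s a) b = exch (incr A a) s b); last by mi_eq.
  by rewrite (_ : incr (exch B a s) a = exch (incr B b) b s) //; mi_eq.
(* The exchanged pair still has excess at [a]. A second exchange there either finds a valid witness
   or gives [s] back, which leaves the crossed lifts of [common']. *)
set P := exch (incr A a) s b in tle; set Q := exch (incr B b) b s in tle.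
have dQ : Q = incr B s by rewrite /Q; mi_eq.
have dP : incr P s = incr (incr A a) b by rewrite /P; mi_eq.
have [||| v vP vle] := exf P Q a.
- by have := mdeg_incr P s; rewrite dP !mdeg_incr dA; case.
- by rewrite dQ mdeg_incr dB.
- by rewrite dQ /P !ffunE eqxx (negPf nas); lia.
have [vs|vs] := eqVneq v s.
  subst v; apply: common'; rewrite E1; apply: (le_trans tle); apply: (le_trans vle).
  rewrite (_ : exch P a s = incr A b); last by rewrite /P; mi_eq.
  by rewrite (_ : exch Q s a = incr B a) // dQ; mi_eq.
have vAB : (A v < B v)%N by move: vP; rewrite dQ /P !ffunE (negPf vs); lia.
apply: (done v b a) => //; rewrite E1; apply: (le_trans tle); apply: (le_trans vle).
rewrite (_ : incr (exch A s v) b = exch P a v); last by rewrite /P; mi_eq.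
by rewrite (_ : incr (exch B v s) a = exch Q v a) // dQ; mi_eq.
Qed.

(** * Hessians of the generating polynomial *)

(* With f read as the derivatives at 0 of a power series F, this is the m-th
   derivative of D^g F at 0 in the direction (z, 1, ..., 1), where z is the
   coordinate of the homogenising variable. Prescribing it by recursion makes
   Euler's identity (dirDS) definitional. *)
Fixpoint dirD (K : pzRingType) (E : finType) (f : {ffun E -> nat} -> K) (z : K)
    (m : nat) (g : {ffun E -> nat}) : K :=
  if m is m'.+1 then z * dirD f z m' g + \sum_i dirD f z m' (incr g i) else f g.

(* None indexes the homogenising variable: differentiating in it only lowers
   the degree m in dirD, so it leaves the multi-index unchanged. *)
Definition oincr {E : finType} (g : {ffun E -> nat}) (o : option E) :=
  if o is Some i then incr g i else g.

Definition weight {R : pzRingType} {E : finType} (z : R) (o : option E) : R :=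
  if o is Some _ then 1 else z.

Lemma oincrC {E : finType} (g : {ffun E -> nat}) o p :
  oincr (oincr g o) p = oincr (oincr g p) o.
Proof. by case: o p => [i|] [j|] //=; apply: incrC. Qed.

Lemma sum_option (V : nmodType) (E : finType) (F : option E -> V) :
  \sum_o F o = F None + \sum_i F (Some i).
Proof.
rewrite (bigD1 None) //=; congr (_ + _).
rewrite (reindex_omap Some id) //=; last by case.
by apply: eq_bigl => i; rewrite eqxx.
Qed.

Lemma dirDS (K : pzRingType) (E : finType) (f : {ffun E -> nat} -> K) z m g :
  dirD f z m.+1 g = \sum_(o : option E) weight z o * dirD f z m (oincr g o).
Proof.
by rewrite sum_option /=; congr (_ + _); apply: eq_bigr => i _; rewrite mul1r.
Qed.

(** The witness of an exchange at [i] is [k] or [l], which gives the two terms; without excess at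
    [i], [i] is itself [k] or [l] and one term equals the left side. *)
Lemma four_term_exchange (R : realDomainType) (E : finType)
    (f : {ffun E -> nat} -> R) g (i j k l : E) :
  exchange (mdeg g).+2 f ->
  f (incr (incr g i) j) * f (incr (incr g k) l) <=
  Num.max (f (incr (incr g i) k) * f (incr (incr g j) l))
          (f (incr (incr g i) l) * f (incr (incr g j) k)).
Proof.
move=> exf; rewrite le_max; pose F p q := f (incr (incr g p) q).
rewrite -!/(F _ _).
have symF p q : F p q = F q p by rewrite /F incrC.
have [ltba|leab] := ltnP (incr (incr g k) l i) (incr (incr g i) j i).
  have [||t tP] := exf (incr (incr g i) j) (incr (incr g k) l) i _ _ ltba; rewrite ?mdeg_incr //.
  have [tk|tk] := eqVneq t k.
    subst t => h; apply/orP; right; rewrite [X in _ <= X]mulrC; apply: (le_trans h).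
    rewrite (_ : exch (incr (incr g i) j) i k = incr (incr g j) k); last by mi_eq.
    by rewrite (_ : exch (incr (incr g k) l) k i = incr (incr g i) l) //; mi_eq.
  have tl : t = l.
    by apply/eqP; move: tP; rewrite !ffunE (negPf tk); case: eqP => // _; lia.
  subst t => h; apply/orP; left; rewrite [X in _ <= X]mulrC; apply: (le_trans h).
  rewrite (_ : exch (incr (incr g i) j) i l = incr (incr g j) l); last by mi_eq.
  by rewrite (_ : exch (incr (incr g k) l) l i = incr (incr g i) k) //; mi_eq.
have [ik|ik] := eqVneq i k; first by subst k; rewrite mulrC (symF j i) lexx orbT.
have il : i = l.
  apply/eqP; move: leab; rewrite !ffunE eqxx (negPf ik); case: (i =P l) => // _; lia.
by subst l; rewrite [F i j * _]mulrC (symF k i) (symF j i) lexx.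
Qed.

Section Lorentzian.
Variables (R : realFieldType) (E : finType) (r : nat) (f : {ffun E -> nat} -> R) (z : R).
Hypothesis f_ge0 : forall a, 0 <= f a.
Hypothesis f_mono : forall a e, f (incr a e) <= f a.
Hypothesis f_att : forall a (s : E), (mdeg a < r)%N -> exists e, f a = f (incr a e).
Hypothesis f_exch : forall m, (m <= r)%N -> exchange m f.
Hypothesis z_gt0 : 0 < z.

Lemma dirD_ge0 m g : 0 <= dirD f z m g.
Proof.
elim: m g => [|m IHm] g /=; first exact: f_ge0.
by rewrite addr_ge0 ?mulr_ge0 ?(ltW z_gt0) // sumr_ge0.
Qed.

Lemma dirD_mono m g e : dirD f z m (incr g e) <= dirD f z m g.
Proof.
elim: m g => [|m IHm] g /=; first exact: f_mono.
rewrite lerD ?ler_wpM2l ?(ltW z_gt0) //; apply: ler_sum => i _.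
by rewrite incrC.
Qed.

(** The Hessian at [(z, 1, ..., 1)] up to a positive factor, with rows and columns scaled by the
    coordinates so that the all-ones vector represents the point itself. *)
Definition hessian m g (i j : option E) : R :=
  weight z i * weight z j * dirD f z m (oincr (oincr g i) j).

Lemma weight_gt0 (o : option E) : 0 < weight z o.
Proof. by case: o => [i|] //=. Qed.

Lemma hessian_sym m g i j : hessian m g i j = hessian m g j i.
Proof. by rewrite /hessian oincrC [weight z i * _]mulrC. Qed.

Lemma hessian_ge0 m g i j : 0 <= hessian m g i j.
Proof. by rewrite !mulr_ge0 ?(ltW (weight_gt0 _)) ?dirD_ge0. Qed.

(** For [i], [j] in [E], [f_att] rewrites [D k None] with two increments of [g]; after the four-term
    exchange, [f_mono] drops the added ones. If [i] or [j] is [None], the left side is a term on the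
    right. *)
Lemma f_four_point g : ((mdeg g).+2 <= r)%N ->
  let D (i j : option E) := f (oincr (oincr g i) j) in
  forall i j k, D k None * D i j <= Num.max (D i None * D k j) (D j None * D i k).
Proof.
move=> gr D.
have symD i j : D i j = D j i by rewrite /D oincrC.
have att1 k (s : E) : exists p, f (incr g k) = D (Some k) (Some p).
  by have [|p ->] := @f_att (incr g k) s; [rewrite mdeg_incr | exists p].
have exg := f_exch gr.
have FF i j k l := @four_term_exchange _ _ f g i j k l exg.
have Dmono i j : D i j <= D i None by case: j => [j|] //=; apply: f_mono.
move=> [i|] [j|] [k|]; rewrite le_max.
- have [p pE] := att1 k k.
  have -> : D (Some k) None = D (Some k) (Some p) := pE; have := FF k p i j; rewrite le_max => /orP[] h; apply/orP.
    right; apply: (le_trans h); rewrite mulrC; apply: ler_pM; rewrite ?f_ge0 //.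
      by rewrite incrC; apply: f_mono.
    by rewrite /D /= incrC.
  left; apply: (le_trans h); rewrite mulrC; apply: ler_pM; rewrite ?f_ge0 //.
  by rewrite incrC; apply: f_mono.
- have [|p pE] := @f_att g i; first by lia.
  have [p' p'E] := att1 p i.
  have -> : D None None = D (Some p) (Some p') := etrans pE p'E; have := FF p p' i j; rewrite le_max => /orP[] h; apply/orP.
    left; apply: (le_trans h); apply: ler_pM; rewrite ?f_ge0 //.
      by rewrite incrC; apply: f_mono.
    by rewrite incrC; apply: f_mono.
  right; apply: (le_trans h); apply: ler_pM; rewrite ?f_ge0 //.
    by rewrite incrC; apply: f_mono.
  by rewrite incrC; apply: f_mono.
- by rewrite mulrC lexx.
- by rewrite mulrC lexx.
- by rewrite (symD None (Some j)) mulrC lexx orbT.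
- by rewrite (symD None (Some j)) mulrC lexx orbT.
- by rewrite (symD None (Some k)) mulrC lexx.
- by rewrite lexx.
Qed.

Lemma reverse_CS_hessian m g : (mdeg g + m.+2 <= r)%N -> reverse_CS (hessian m g).
Proof.
elim: m g => [|m IHm] g gr.
  pose D (i j : option E) := f (oincr (oincr g i) j).
  have symD i j : D i j = D j i by rewrite /D oincrC.
  have Dmono i j : D i j <= D i None by case: j => [j|] //=; apply: f_mono.
  have fp := @f_four_point g _; rewrite addn2 in gr.
  have bnd := four_point_rank1_bound symD (fun i j => f_ge0 _) Dmono (fp gr).
  (* The rank one bound needs [f g > 0]; when [f g = 0], monotonicity makes every entry vanish. *)
  have [g0|g0] := eqVneq (f g) 0.
    have H0 i j : hessian 0 g i j = 0.
      suff D0 : D i j = 0 by rewrite /hessian /= -/(D i j) D0 mulr0.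
      apply/eqP; rewrite eq_le f_ge0 andbT -g0.
      apply: (le_trans (Dmono _ _)); rewrite symD; exact: Dmono.
    move=> x; rewrite /bil big1 ?mul0r ?sqr_ge0 // => i _; rewrite big1 ?mulr0 // => j _.
    by rewrite H0 mul0r.
  apply: (@reverse_CS_of_rank1_bound _ _ _ (f g) (fun i => D i None * weight z i)).
  - exact: hessian_sym.
  - exact: hessian_ge0.
  - by rewrite lt_neqAle eq_sym g0 f_ge0.
  move=> x.
  rewrite (_ : bil _ x x = bil D (fun i => weight z i * x i) (fun i => weight z i * x i)).
    by apply: le_trans (bnd _) _; under eq_bigr do rewrite mulrA.
  apply: eq_bigr => i _; rewrite !mulr_sumr; apply: eq_bigr => j _.
  by rewrite /hessian /= -/(D i j); ring.
apply: (@reverse_CS_sum _ _ None _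
   (fun k i j => weight z k * hessian m (oincr g k) i j)).
- exact: hessian_sym.
(* Replacing [j] by [None] undoes an increment, so [dirD] can only grow: this is the link to the
   homogenising variable. *)
- move=> i j; rewrite {1}/hessian => h0.
  have h : 0 < dirD f z m.+1 (oincr (oincr g i) j).
    by move: h0; rewrite pmulr_rgt0 // mulr_gt0 ?weight_gt0.
  rewrite !mulr_gt0 ?weight_gt0 //; apply: (lt_le_trans h).
  by case: j {h h0} => [j|] //; apply: dirD_mono.
- by move=> k i j; rewrite mulr_ge0 ?hessian_ge0 // ltW ?weight_gt0.
- move=> i j; rewrite /hessian dirDS mulr_sumr; apply: eq_bigr => k _.
  by rewrite (oincrC _ j) (oincrC _ i) ; ring.
- move=> k i; rewrite /hessian dirDS mulr_sumr; apply: eq_bigr => j _; ring.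
- move=> k x.
  have bilZ y : bil (fun i j => weight z k * hessian m (oincr g k) i j) x y =
     weight z k * bil (hessian m (oincr g k)) x y.
    rewrite /bil mulr_sumr; apply: eq_bigr => i _; rewrite !mulr_sumr.
    by apply: eq_bigr => j _; ring.
  have bilZ1 y : bil (fun i j => weight z k * hessian m (oincr g k) i j) (fun=> 1) y =
     weight z k * bil (hessian m (oincr g k)) (fun=> 1) y.
    rewrite /bil mulr_sumr; apply: eq_bigr => i _; rewrite !mulr_sumr.
    by apply: eq_bigr => j _; ring.
  rewrite !bilZ bilZ1 mulrACA exprMn -expr2 ler_wpM2l ?sqr_ge0 //.
  apply: IHm; case: k {bilZ bilZ1} => [k|] /=; rewrite ?mdeg_incr; lia.
Qed.

(** Take the indicator of [None] in [reverse_CS_hessian]: the entry, row sum and total are [z^2],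
    [z] and 1 times the three [dirD] values, so [z^2] cancels. *)
Lemma dirD_log_concave m g : (mdeg g + m.+2 <= r)%N ->
  dirD f z m g * dirD f z m.+2 g <= dirD f z m.+1 g ^+ 2.
Proof.
move=> gr.
have := reverse_CS_hessian gr (fun o => (o == None)%:R).
have row i : \sum_j hessian m g i j = weight z i * dirD f z m.+1 (oincr g i).
  by rewrite dirDS mulr_sumr; apply: eq_bigr => j _; rewrite mulrA.
have delta (F : option E -> R) : \sum_i (i == None)%:R * F i = F None.
  rewrite sum_option /= mul1r big1 ?addr0 // => i _; exact: mul0r.
rewrite !bilr1 delta row /=.
have -> : \sum_i 1 * (\sum_j hessian m g i j) = dirD f z m.+2 g.
  by rewrite dirDS; apply: eq_bigr => i _; rewrite mul1r row.
rewrite /bil delta /=.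
under eq_bigr do rewrite mulrC.
rewrite delta /hessian /= -/(dirD f z m.+1 g) -expr2 exprMn -mulrA.
by rewrite ler_pM2l // exprn_gt0.
Qed.

End Lorentzian.

(** * Specialisation at the boundary point *)

(** With the polynomial variable in place of [z], log-concavity becomes a polynomial inequality and
    extends from [z > 0] to [z = 0]. *)
Lemma dirD_horner (R : comNzRingType) (E : finType) (f : {ffun E -> nat} -> R) (z : R) m g :
  (dirD (fun a => (f a)%:P) 'X m g).[z] = dirD f z m g.
Proof.
elim: m g => [|m IHm] g /=; first by rewrite hornerC.
rewrite hornerD hornerM hornerX horner_sum IHm; congr (_ + _).
by apply: eq_bigr => i _; rewrite IHm.
Qed.

Lemma poly_ge0_at0 (R : rcfType) (p : {poly R}) :
  (forall z, 0 < z -> 0 <= p.[z]) -> 0 <= p.[0].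
Proof.
move=> p_ge0; rewrite leNgt; apply/negP => p0.
have [|d d_gt0 /(_ (d / 2))] := @polyrcf.poly_cont _ 0 p (- p.[0]).
  by rewrite oppr_gt0.
rewrite subr0 gtr0_norm ?divr_gt0 // ltr_pdivrMr // mulr_natr mulr2n ltrDl d_gt0.
move=> /(_ isT); rewrite ltNge; apply/negP/negPn.
have := p_ge0 (d / 2); rewrite divr_gt0 // => /(_ isT) h.
by rewrite (le_trans _ (ler_norm _)) // lerDr.
Qed.

(** * Level sums and their Euler identity *)

Section BoundedSums.
Variables (R : realFieldType) (E : finType) (r : nat) (f : {ffun E -> nat} -> R).

Definition addmi (g a : {ffun E -> nat}) : {ffun E -> nat} := [ffun e => (g e + a e)%N].

Definition level_sum (g : {ffun E -> nat}) (m : nat) : R :=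
  \sum_(a : {ffun E -> 'I_r.+1} | mdeg (lft a) == m)
     f (addmi g (lft a)) / (mfact (lft a))%:R.

Lemma mfact_incr (a : {ffun E -> nat}) i : mfact (incr a i) = ((a i).+1 * mfact a)%N.
Proof.
rewrite /mfact (bigD1 i) //= [in RHS](bigD1 i) //= mulnA !ffunE eqxx addn1 factS.
by congr (_ * _)%N; apply: eq_bigr => j /negPf ji; rewrite ffunE ji addn0.
Qed.

Lemma mfact_gt0 (a : {ffun E -> nat}) : (0 < mfact a)%N.
Proof. by rewrite /mfact prodn_gt0 // => e; apply: fact_gt0. Qed.

Lemma le_mdeg (a : {ffun E -> nat}) e : (a e <= mdeg a)%N.
Proof. by rewrite /mdeg (bigD1 e) //= leq_addr. Qed.

Lemma level_sum0 g : level_sum g 0 = f g.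
Proof.
rewrite /level_sum (big_pred1 [ffun=> ord0]) /=.
  have -> : lft ([ffun=> ord0] : {ffun E -> 'I_r.+1}) = [ffun=> 0%N].
    by apply/ffunP => e; rewrite !ffunE.
  have -> : addmi g [ffun=> 0%N] = g by apply/ffunP => e; rewrite !ffunE addn0.
  by rewrite /mfact big1 ?divr1 // => e _; rewrite ffunE.
move=> a; apply/eqP/eqP => [a0|->]; last by rewrite /mdeg big1 // => e _; rewrite !ffunE.
apply/ffunP => e; apply/val_inj; have := le_mdeg (lft a) e.
by rewrite a0 leqn0 !ffunE => /eqP.
Qed.

(** Insert the factor [m.+1 = \sum_i a i] and remove one unit at [i] from each index: [a i / a!]
    becomes the reciprocal factorial of the smaller index. *)
Lemma level_sumS g m : (m < r)%N ->
  m.+1%:R * level_sum g m.+1 = \sum_i level_sum (incr g i) m.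
Proof.
move=> mr; rewrite /level_sum mulr_sumr.
transitivity (\sum_i \sum_(a : {ffun E -> 'I_r.+1} | mdeg (lft a) == m.+1)
    (lft a i)%:R * (f (addmi g (lft a)) / (mfact (lft a))%:R)).
  rewrite exchange_big; apply: eq_bigr => a /eqP am /=.
  by rewrite -mulr_suml -natr_sum -/(mdeg (lft a)) am.
apply: eq_bigr => i _.
rewrite (bigID (fun a : {ffun E -> 'I_r.+1} => (0 < lft a i)%N)) /= [X in _ + X]big1 ?addr0; last first.
  by move=> a /andP[_]; rewrite -eqn0Ngt => /eqP ->; rewrite mul0r.
(* For [a] of degree [m < r] the raised entries stay at most [r], so [inord] does not fall back to
   0. *)
pose up (a : {ffun E -> 'I_r.+1}) : {ffun E -> 'I_r.+1} := [ffun e => inord (a e + (e == i))].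
pose down (a : {ffun E -> 'I_r.+1}) : {ffun E -> 'I_r.+1} := [ffun e => inord (a e - (e == i))].
have lft_down b : (0 < lft b i)%N -> incr (lft (down b)) i = lft b.
  move=> b0; apply/ffunP => e; rewrite !ffunE inordK; last first.
    by rewrite ltnS (leq_trans (leq_subr _ _)) // -ltnS.
  by rewrite subnK //; case: eqP => // ->; move: b0; rewrite ffunE.
have lft_up a : mdeg (lft a) = m -> lft (up a) = incr (lft a) i.
  move=> am; apply/ffunP => e; rewrite !ffunE inordK //.
  by have := le_mdeg (lft a) e; rewrite am ffunE; case: eqP => _ /=; lia.
have lft_inj (a b : {ffun E -> 'I_r.+1}) : lft a = lft b -> a = b.
  by move=> ab; apply/ffunP => e; apply/val_inj; have /ffunP/(_ e) := ab; rewrite !ffunE.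
have incr_inj (a b : {ffun E -> nat}) : incr a i = incr b i -> a = b.
  by move=> ab; apply/ffunP => e; have /ffunP/(_ e) := ab; rewrite !ffunE => /addIn.
have downP b : mdeg (lft b) = m.+1 -> (0 < lft b i)%N -> mdeg (lft (down b)) = m.
  by move=> bm b0; have := mdeg_incr (lft (down b)) i; rewrite lft_down // bm => -[].
rewrite (reindex_onto up down) /=; last first.
  move=> b /andP[/eqP bm b0]; apply: lft_inj.
  by rewrite lft_up ?lft_down // downP.
apply: eq_big => [a|a /andP[/andP[/eqP um u0] /eqP du]].
  apply/andP/eqP => [[/andP[/eqP um u0] /eqP du]|am].
    by rewrite -du downP.
  rewrite lft_up // mdeg_incr am eqxx; split; first by rewrite !ffunE eqxx addn1.
  apply/eqP/lft_inj/incr_inj; rewrite lft_down lft_up //.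
  by rewrite !ffunE eqxx addn1.
have am : mdeg (lft a) = m by rewrite -du downP.
rewrite lft_up // mfact_incr.
have -> : addmi g (incr (lft a) i) = addmi (incr g i) (lft a).
  by apply/ffunP => e; rewrite !ffunE addnAC addnA.
have -> : incr (lft a) i i = (lft a i).+1 by rewrite ffunE eqxx addn1.
have m0 : (mfact (lft a))%:R != 0 :> R by rewrite pnatr_eq0 -lt0n mfact_gt0.
rewrite natrM; field.
by rewrite m0 addrC natr1 pnatr_eq0.
Qed.

Lemma dirD_level_sum g m : (m <= r)%N -> dirD f 0 m g = m`!%:R * level_sum g m.
Proof.
elim: m g => [|m IHm] g mr /=; first by rewrite level_sum0 fact0 mul1r.
rewrite mul0r add0r factS mulnC natrM -mulrA level_sumS // mulr_sumr.
by apply: eq_bigr => i _; rewrite IHm // ltnW.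
Qed.

End BoundedSums.

(** * The weights of a valuated polymatroid *)

Section Nutilde.
Variables (R : realType) (E : finType).

Lemma ole_refl (x : option R) : ole x x.
Proof. by case: x => //= x; rewrite lexx. Qed.

Lemma ole_trans (y x z : option R) : ole x y -> ole y z -> ole x z.
Proof. by case: x y z => [x|] [y|] [z|] //=; apply: le_trans. Qed.

Lemma omin_le (x y : option R) : ole (omin x y) x && ole (omin x y) y.
Proof.
rewrite /omin; case: ifP => [xy|]; first by rewrite ole_refl.
rewrite ole_refl andbT; case: x y => [x|] [y|] //=.
by move/negbT; rewrite -ltNge => /ltW.
Qed.

Lemma big_omin_le (T : finType) (P : pred T) (F : T -> option R) b :
  P b -> ole (\big[omin/None]_(a | P a) F a) (F b).
Proof.
move=> Pb; have : b \in index_enum T by apply: mem_index_enum.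
elim: (index_enum T) => // a s IHs; rewrite inE big_cons => /orP[/eqP <-|/IHs h].
  by rewrite Pb; have /andP[] := omin_le (F b) (\big[omin/None]_(a <- s | P a) F a).
case: ifP => // _; apply: ole_trans h.
by have /andP[] := omin_le (F a) (\big[omin/None]_(a <- s | P a) F a).
Qed.

Lemma big_omin_attained (T : finType) (P : pred T) (F : T -> option R) :
  \big[omin/None]_(a | P a) F a = None \/
  exists2 b, P b & \big[omin/None]_(a | P a) F a = F b.
Proof.
apply: (big_ind (fun x => x = None \/ exists2 b, P b & x = F b)); first by left.
  by move=> x y hx hy; rewrite /omin; case: ifP.
by move=> a Pa; right; exists a.
Qed.

Variables (q : R) (q_gt0 : 0 < q) (q_le1 : q <= 1).

Lemma qpow_ge0 x : 0 <= qpow q x.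
Proof. by case: x => [x|] //=; apply: powR_ge0. Qed.

Lemma le_qpow x y : ole x y -> qpow q y <= qpow q x.
Proof.
case: x y => [x|] [y|] //=; last by rewrite powR_ge0.
by apply: ger_powR; rewrite q_gt0.
Qed.

Lemma qpow_oadd x y : qpow q (oadd x y) = qpow q x * qpow q y.
Proof.
case: x y => [x|] [y|] //=; rewrite ?mul0r ?mulr0 // powRD //.
by rewrite (gt_eqF q_gt0) implybT.
Qed.

Variables (r : nat) (nu : {ffun E -> nat} -> option R).

Definition wt (a : {ffun E -> nat}) : R := qpow q (nutilde r nu a).

Lemma lft_surj (b : {ffun E -> nat}) : mdeg b = r ->
  exists b' : {ffun E -> 'I_r.+1}, lft b' = b.
Proof.
move=> br; exists [ffun e => inord (b e)]; apply/ffunP => e.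
by rewrite !ffunE inordK // ltnS -br le_mdeg.
Qed.

Lemma wt_ge (a b : {ffun E -> nat}) : mdeg b = r -> (forall e, (a e <= b e)%N) -> qpow q (nu b) <= wt a.
Proof.
move=> br ab; have [b' b'E] := lft_surj br; rewrite -b'E; apply: le_qpow.
apply: (@big_omin_le _ _ (fun b => nu (lft b))); rewrite b'E /inDelta br eqxx.
exact/forallP.
Qed.

Lemma wt_attained (a : {ffun E -> nat}) : wt a = 0 \/
  exists b, [/\ mdeg b = r, (forall e, (a e <= b e)%N) & wt a = qpow q (nu b)].
Proof.
rewrite /wt /nutilde.
case: (@big_omin_attained _ (fun b : {ffun E -> 'I_r.+1} =>
    inDelta r (lft b) && [forall e, (a e <= lft b e)%N]) (fun b => nu (lft b))).
  by move=> ->; left.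
move=> [b /andP[/eqP br /forallP ab] ->]; right; by exists (lft b).
Qed.

Lemma wt_top a : mdeg a = r -> wt a = qpow q (nu a).
Proof.
move=> ar; apply/eqP; rewrite eq_le (wt_ge ar) // andbT.
have [->|[b [br ab ->]]] := wt_attained a; first exact: qpow_ge0.
suff -> : a = b by [].
apply/ffunP => e; apply/eqP; rewrite eqn_leq ab /=.
have le_sum : (\sum_(i | i != e) a i <= \sum_(i | i != e) b i)%N by apply: leq_sum.
by move: ar br; rewrite /mdeg (bigD1 e) //= [X in _ -> X = _ -> _](bigD1 e) //=; lia.
Qed.

Lemma wt_mono a e : wt (incr a e) <= wt a.
Proof.
have [->|[b [br ab ->]]] := wt_attained (incr a e); first exact: qpow_ge0.
by apply: wt_ge => // i; have := ab i; rewrite ffunE; lia.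
Qed.

(** A minimiser for [a] has degree [r > mdeg a], hence lies above [incr a e] for some [e]. When
    [wt a = 0] any element works, and [s] supplies one. *)
Lemma wt_next a (s : E) : (mdeg a < r)%N -> exists e, wt a = wt (incr a e).
Proof.
move=> ar; have [a0|[b [br ab abE]]] := wt_attained a.
  by exists s; apply/eqP; rewrite eq_le wt_mono andbT a0 qpow_ge0.
have [e ltab] : exists e, (a e < b e)%N.
  apply/existsP; apply: contraTT ar; rewrite negb_exists => /forallP h.
  by rewrite -leqNgt -br; apply: leq_sum => e _; rewrite leqNgt.
exists e; apply/eqP; rewrite eq_le wt_mono andbT abE.
by apply: wt_ge => // i; rewrite ffunE; case: eqP => [->|_]; rewrite ?addn1 // addn0.
Qed.

Lemma mdeg_exch m (a : {ffun E -> nat}) s t : (0 < a s)%N -> mdeg a = m -> mdeg (exch a s t) = m.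
Proof.
move=> a0 am; have : incr (exch a s t) s = incr a t by mi_eq.
by move/(congr1 mdeg); rewrite !mdeg_incr am => -[].
Qed.

Lemma wt_exchange (G : {pred R}) m : Mconvex G r nu -> (m <= r)%N -> exchange m wt.
Proof.
move=> [_ [_ exnu]] mr; rewrite -(subKn mr).
(* Downward induction on the level, starting at [r], where [wt] is [q^nu]. *)
elim: (r - m)%N (leq_subr m r) => [_|k IHk kr].
  rewrite subn0 => a b s ar br lt_s.
  have [|| t [lt_t le_nu]] := exnu a b s _ _ lt_s; rewrite ?/inDelta ?ar ?br //.
  exists t => //; rewrite !wt_top // ?(mdeg_exch (m := r)) //; try lia.
  by rewrite -!qpow_oadd le_qpow.
apply: exchange_truncation.
- by move=> a; apply: qpow_ge0.
- exact: wt_mono.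
- by move=> a s ak; apply: (wt_next s); lia.
- by rewrite -subSn // subSS; apply: IHk; lia.
Qed.

End Nutilde.

Theorem theoremB (R : realType) (G : {pred R}) (E : finType) (r : nat)
  (nu : {ffun E -> nat} -> option R) (q : R) :
  addsubgroup G -> Mconvex G r nu -> 0 < q -> q <= 1 ->
  forall k : nat, (1 <= k)%N -> (k < r)%N ->
    Ik r nu q k ^+ 2 >= (k.+1)%:R / k%:R * Ik r nu q k.+1 * Ik r nu q k.-1.
Proof.
(* From here on [k] is the predecessor of the index in the statement. *)
move=> _ convex q_gt0 q_le1 [//|k] _ kr /=.
pose f := wt q r nu; pose zero : {ffun E -> nat} := [ffun=> 0%N].
have zero_deg : mdeg zero = 0%N by rewrite /mdeg big1 // => e _; rewrite ffunE.
pose P m := dirD (fun a => (f a)%:P) 'X m zero.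
have P0 m : (m <= r)%N -> (P m).[0] = m`!%:R * Ik r nu q m.
  move=> mr; rewrite dirD_horner (dirD_level_sum _ _ mr); congr (_ * _).
  apply: eq_bigr => a _; rewrite (_ : addmi _ _ = lft a) //.
  by apply/ffunP => e; rewrite !ffunE.
have : 0 <= (P k.+1 ^+ 2 - P k * P k.+2).[0].
  apply: poly_ge0_at0 => z z_gt0.
  rewrite expr2 hornerD hornerN !hornerM -expr2 !dirD_horner subr_ge0.
  apply: (@dirD_log_concave _ _ r) => //.
  - by move=> a; apply: qpow_ge0.
  - by move=> a e; apply: wt_mono.
  - by move=> a s; apply: wt_next.
  - by move=> m; apply: wt_exchange convex.
  - by rewrite zero_deg.
rewrite expr2 hornerD hornerN !hornerM -expr2 !P0 ?(ltnW kr) ?(ltnW (ltnW kr)) //.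
have k_gt0 : 0 < k`!%:R :> R by rewrite ltr0n fact_gt0.
(* The constant is [k! (k+2)! / (k+1)!^2 = (k+2)/(k+1)]. *)
rewrite !factS !natrM.
set a := Ik r nu q k; set b := Ik r nu q k.+1; set c := Ik r nu q k.+2.
have -> : (k.+1%:R * k`!%:R * b) ^+ 2 - k`!%:R * a * (k.+2%:R * (k.+1%:R * k`!%:R) * c) =
   (k`!%:R * k.+1%:R) ^+ 2 * (b ^+ 2 - k.+2%:R / k.+1%:R * c * a).
  by field; rewrite addrC natr1 pnatr_eq0.
by rewrite pmulr_rge0 ?subr_ge0 // exprn_gt0 // mulr_gt0 // ltr0n.
Qed.
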